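(* For each simple root $\alpha$ let $Z_\alpha=a_\alpha+b_\alpha\delta_\alpha\in Q_W$ with $a_\alpha,b_\alpha\in Q$ and $b_\alpha$ invertible, and fix a reduced sequence $I_w$ for each $w\in W$. For $w\in W$, define $W\times W$ matrices over $Q$ by $$\mathfrak{p}^Z_w(u,v)=\mathbb{c}^{I_v}_{I_w,I_u},\qquad \mathfrak{b}^Z(u,v)=b^Z_{v,I_u},\qquad \mathfrak{b}^Z_w(u,v)=\delta_{u,v}\,b^Z_{u,I_w},$$ where $\delta_{u,v}$ is the Kronecker delta. Then for any $w\in W$, $$\mathfrak{p}^Z_w=\mathfrak{b}^Z\cdot\mathfrak{b}^Z_w\cdot(\mathfrak{b}^Z)^{-1}.$$
   Context: Let $\Sigma\hookrightarrow\Lambda^\vee$ be a semisimple root datum of rank $n$ with lattice $\Lambda\supset\Sigma$, simple roots $\alpha_1,\dots,\alpha_n$, and Weyl group $W$ generated by $s_i=s_{\alpha_i}$. Let $F$ be a one-dimensional commutative formal group law over a commutative ring $R$. The formal group algebra is $S=R[[x_\lambda\mid\lambda\in\Lambda]]/J_F$, where $J_F$ is the closure of the ideal generated by $x_0$ and all $x_{\lambda+\mu}-F(x_\lambda,x_\mu)$, $\lambda,\mu\in\Lambda$; $W$ acts on $S$ by $w(x_\lambda)=x_{w(\lambda)}$. Standing assumption (regularity): $x_\alpha$ is a non-zero-divisor in $S$ for all $\alpha\in\Sigma$. Let $Q=S[\frac1{x_\alpha}\mid\alpha\in\Sigma]$, with the induced $W$-action. $Q_W=Q\rtimes R[W]$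 is the free left $Q$-module with basis $\{\delta_w\}_{w\in W}$ and product $(p\delta_w)(p'\delta_{w'})=p\,w(p')\,\delta_{ww'}$; write $\delta_\alpha=\delta_{s_\alpha}$, $1=\delta_e$. For a sequence $I=(i_1,\dots,i_k)$, $Z_I=Z_{\alpha_{i_1}}\cdots Z_{\alpha_{i_k}}$; $I_w$ is a reduced sequence for $w$ if $w=s_{i_1}\cdots s_{i_k}$ is a reduced expression. The elements $\{Z_{I_w}\}_{w\in W}$ form a $Q$-basis of $Q_W$. The coefficients $b^Z_{u,I_w}\in Q$ are defined by $\delta_u=\sum_{w\in W}b^Z_{u,I_w}Z_{I_w}$. $Q_W^*=\operatorname{Hom}_Q(Q_W,Q)$ has the basis $\{f_w\}$ dual to $\{\delta_w\}$ and the basis $\{Z_{I_w}^*\}$ dual to $\{Z_{I_w}\}$; it is a commutative ring with $Q$-bilinear product $f_wf_v=f_w$ if $w=v$ and $0$ otherwise. The structure constants $\mathbb{c}^{I_w}_{I_u,I_v}\in Q$ are defined by $Z_{I_u}^*Z_{I_v}^*=\sum_{w\in W}\mathbb{c}^{I_w}_{I_u,I_v}Z_{I_w}^*$. *)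

(* Defs.v *)
From HB Require Import structures.
From mathcomp Require Import all_boot all_order all_algebra fingroup finmap.
From mathcomp Require Import generic_quotient ring_quotient monalg ring.
From mathcomp Require Import boolp classical_sets functions.

Set Implicit Arguments.
Unset Strict Implicit.
Unset Printing Implicit Defensive.

Import GRing.Theory.
Local Open Scope ring_scope.
Local Open Scope quotient_scope.

(* R[[x_t | t in T]] is the completion of the polynomial ring
   R[x_t | t in T] = {malg R[{cmonom T}]} with respect to the powers of the
   ideal generated by the variables.  As R[x]/I^d is the sum of the
   homogeneous components of degree < d, an element of the limit of the
   R[x]/I^d is the same thing as a sequence of homogeneous polynomials, one in
   each degree.  T may be infinite: only finitely many monomials of a given
   degree occur. *)

Definition homog (T : choiceType) (R : comNzRingType) (d : nat)
    (p : {malg R[{cmonom T}]}) : bool :=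
  all (fun m => mdeg m == d) (msupp p).

Lemma homogP (T : choiceType) (R : comNzRingType) d (p : {malg R[{cmonom T}]}) :
  reflect (forall m, p@_m != 0 -> mdeg m = d) (homog d p).
Proof.
apply: (iffP allP) => h m; last by move=> hm; apply/eqP/h; rewrite mcoeff_neq0.
by rewrite mcoeff_neq0 => /h/eqP.
Qed.

Record fps (T : choiceType) (R : comNzRingType) := Fps {
  hcomp :> nat -> {malg R[{cmonom T}]};
  hcompP : forall d, homog d (hcomp d)
}.

HB.instance Definition _ T R := gen_eqMixin (fps T R).
HB.instance Definition _ T R := gen_choiceMixin (fps T R).

Section FpsRing.
Variables (T : choiceType) (R : comNzRingType).
Local Notation P := {malg R[{cmonom T}]}.
Implicit Types (p q : P) (f g h : fps T R) (m : {cmonom T}).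

Lemma fpsP f g : (forall d, f d = g d) -> f = g.
Proof.
case: f g => [f fP] [g gP] /= e.
have {}e : f = g by apply/funext.
by case: _ / e in gP *; congr Fps; exact: Prop_irrelevance.
Qed.

Lemma homog0 d : homog d (0 : P).
Proof. by apply/homogP => m; rewrite mcoeff0 eqxx. Qed.

Lemma homogD d p q : homog d p -> homog d q -> homog d (p + q).
Proof.
move=> /homogP hp /homogP hq; apply/homogP => m; rewrite mcoeffD.
have [->|/hp//] := eqVneq p@_m 0; rewrite add0r; exact: hq.
Qed.

Lemma homogN d p : homog d p -> homog d (- p).
Proof. by move=> /homogP hp; apply/homogP => m; rewrite mcoeffN oppr_eq0; exact: hp. Qed.

Lemma homog_sum d (I : Type) (r : seq I) (Q : pred I) (F : I -> P) :
  (forall i, Q i -> homog d (F i)) -> homog d (\sum_(i <- r | Q i) F i).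
Proof. by move=> hF; elim/big_ind: _ => // *; [exact: homog0|exact: homogD]. Qed.

Lemma homogU c m : homog (mdeg m) (<< c *g m >> : P).
Proof. by apply/homogP => m'; rewrite mcoeffU; case: (eqVneq m m') => [->|_] //=; rewrite mulr0n eqxx. Qed.

Lemma homogM d e p q : homog d p -> homog e q -> homog (d + e) (p * q).
Proof.
move=> /homogP hp /homogP hq; rewrite malgME big_seq_cond; apply: homog_sum => m1.
rewrite andbT -mcoeff_neq0 => /hp <-; rewrite big_seq_cond; apply: homog_sum => m2.
rewrite andbT -mcoeff_neq0 => /hq <-; rewrite -mdegM; exact: homogU.
Qed.

Definition fps0 := Fps (fun d => homog0 d).
Definition fps_add f g := Fps (fun d => homogD (hcompP f d) (hcompP g d)).
Definition fps_opp f := Fps (fun d => homogN (hcompP f d)).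

Definition fpsU_fun c m d : P := if d == mdeg m then << c *g m >> else 0.
Lemma fpsU_subproof c m d : homog d (fpsU_fun c m d).
Proof.
by rewrite /fpsU_fun; case: eqP => [->|_]; [exact: homogU|exact: homog0].
Qed.
(* the monomial c * m, as a power series *)
Definition fpsU c m := Fps (fpsU_subproof c m).

Lemma fps_mul_subproof f g d : homog d (\sum_(i < d.+1) f i * g (d - i)%N).
Proof.
apply: homog_sum => i _.
rewrite -{1}(subnKC (ltn_ord i : (i <= d)%N)); apply: homogM; exact: hcompP.
Qed.
Definition fps_mul f g := Fps (fps_mul_subproof f g).

Definition trunc N f : {poly P} := \poly_(i < N) f i.

Lemma fps_mulE f g d N M : (d < N)%N -> (d < M)%N ->
  fps_mul f g d = (trunc N f * trunc M g)`_d.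
Proof.
move=> dN dM; rewrite coefM /=; apply: eq_bigr => i _.
have id : (i <= d)%N by rewrite -ltnS.
rewrite !coef_poly (leq_ltn_trans id dN).
by rewrite (leq_ltn_trans (leq_subr i d) dM).
Qed.

Lemma trunc_mul f g d N : (d < N)%N ->
  (trunc N (fps_mul f g))`_d = (trunc N f * trunc N g)`_d.
Proof. by move=> dN; rewrite coef_poly dN; exact: fps_mulE. Qed.

Lemma fps_addA : associative fps_add.
Proof. by move=> f g h; apply: fpsP => d /=; rewrite addrA. Qed.
Lemma fps_addC : commutative fps_add.
Proof. by move=> f g; apply: fpsP => d /=; rewrite addrC. Qed.
Lemma fps_add0 : left_id fps0 fps_add.
Proof. by move=> f; apply: fpsP => d /=; rewrite add0r. Qed.
Lemma fps_addN : left_inverse fps0 fps_opp fps_add.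
Proof. by move=> f; apply: fpsP => d /=; rewrite addNr. Qed.

HB.instance Definition _ :=
  GRing.isZmodule.Build (fps T R) fps_addA fps_addC fps_add0 fps_addN.

Lemma fps_mulC : commutative fps_mul.
Proof.
by move=> f g; apply: fpsP => d; rewrite !(fps_mulE _ _ (ltnSn d) (ltnSn d)) mulrC.
Qed.

Lemma fps_mulA : associative fps_mul.
Proof.
move=> f g h; apply: fpsP => d.
rewrite !(fps_mulE _ _ (ltnSn d) (ltnSn d)).
transitivity ((trunc d.+1 f * (trunc d.+1 g * trunc d.+1 h))`_d).
  rewrite !coefM; apply: eq_bigr => i _; rewrite trunc_mul //.
  by rewrite ltnS leq_subr.
rewrite mulrA !coefM; apply: eq_bigr => i _; by rewrite trunc_mul.
Qed.

Lemma fps_mul1 : left_id (fpsU 1 mone) fps_mul.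
Proof.
move=> f; apply: fpsP => d /=; rewrite big_ord_recl /= big1 ?addr0.
  by rewrite /fpsU_fun mdeg1 eqxx subn0 mul1r.
by move=> i _; rewrite /fpsU_fun mdeg1 mul0r.
Qed.

Lemma fps_mulD : left_distributive fps_mul fps_add.
Proof.
move=> f g h; apply: fpsP => d /=; rewrite -big_split /=.
by apply: eq_bigr => i _; rewrite mulrDl.
Qed.

Lemma fps1_neq0 : fpsU 1 mone != fps0.
Proof.
apply/eqP => /(congr1 (fun f : fps T R => f 0%N)) /= /eqP.
by rewrite /fpsU_fun mdeg1 eqxx /= (oner_eq0 P).
Qed.

HB.instance Definition _ := GRing.Zmodule_isComNzRing.Build (fps T R)
  fps_mulA fps_mulC fps_mul1 fps_mulD fps1_neq0.

Lemma fpsD f g d : (f + g) d = f d + g d. Proof. by []. Qed.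
Lemma fpsN f d : (- f) d = - f d. Proof. by []. Qed.
Lemma fpsB f g d : (f - g) d = f d - g d. Proof. by []. Qed.
Lemma fpsM f g d : (f * g) d = \sum_(i < d.+1) f i * g (d - i)%N.
Proof. by []. Qed.
Lemma fps_sum (I : Type) (r : seq I) (Q : pred I) (F : I -> fps T R) d :
  (\sum_(i <- r | Q i) F i) d = \sum_(i <- r | Q i) F i d.
Proof. by elim/big_rec2: _ => // i p f _ <-. Qed.

End FpsRing.

Definition fpsC (T : choiceType) (R : comNzRingType) (c : R) : fps T R :=
  fpsU c mone.

Definition fpsX (T : choiceType) (R : comNzRingType) (t : T) : fps T R :=
  fpsU 1 (ucm t).

(* The closed ideals of series without terms of degree < k; they form a basis
   of neighbourhoods of 0. *)
Definition fps_ge (T : choiceType) (R : comNzRingType) (k : nat) (f : fps T R)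
  : Prop := forall d, (d < k)%N -> f d = 0.

Section FpsOrder.
Variables (T : choiceType) (R : comNzRingType).
Implicit Types (f g : fps T R).

Lemma fps_geW k l f : (l <= k)%N -> fps_ge k f -> fps_ge l f.
Proof. by move=> lk hf d dl; apply: hf; apply: leq_trans lk. Qed.

Lemma fps_ge_0 k : fps_ge k (0 : fps T R). Proof. by []. Qed.

Lemma fps_geD k f g : fps_ge k f -> fps_ge k g -> fps_ge k (f + g).
Proof. by move=> hf hg d dk; rewrite fpsD hf // hg // addr0. Qed.

Lemma fps_geN k f : fps_ge k f -> fps_ge k (- f).
Proof. by move=> hf d dk; rewrite fpsN hf // oppr0. Qed.

Lemma fps_geB k f g : fps_ge k f -> fps_ge k g -> fps_ge k (f - g).
Proof. by move=> hf hg; apply: fps_geD => //; apply: fps_geN. Qed.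

Lemma fps_ge_sum k (I : Type) (r : seq I) (Q : pred I) (F : I -> fps T R) :
  (forall i, Q i -> fps_ge k (F i)) -> fps_ge k (\sum_(i <- r | Q i) F i).
Proof. by move=> hF; elim/big_ind: _ => // *; exact: fps_geD. Qed.

Lemma fps_geM k l f g : fps_ge k f -> fps_ge l g -> fps_ge (k + l) (f * g).
Proof.
move=> hf hg d dkl; rewrite fpsM big1 // => i _.
have [ik|ki] := ltnP i k; first by rewrite hf // mul0r.
by rewrite hg ?mulr0 // ltn_subLR ?(leq_trans dkl) ?leq_add2r // -ltnS.
Qed.

Lemma fps_geMr k f g : fps_ge k g -> fps_ge k (f * g).
Proof. by rewrite -{2}(add0n k); apply: fps_geM. Qed.

Lemma fps_geX k n f : fps_ge k f -> fps_ge (n * k) (f ^+ n).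
Proof.
move=> hf; elim: n => [//|n IHn]; rewrite exprS mulSn; exact: fps_geM.
Qed.

Lemma fps_ge_prod (I : Type) (r : seq I) (k : I -> nat) (F : I -> fps T R) :
  (forall i, fps_ge (k i) (F i)) ->
  fps_ge (\sum_(i <- r) k i) (\prod_(i <- r) F i).
Proof.
move=> hF; elim: r => [|i r IHr]; first by rewrite !big_nil.
by rewrite !big_cons; apply: fps_geM.
Qed.

Lemma fpsUM (c c' : R) (m m' : {cmonom T}) :
  fpsU c m * fpsU c' m' = fpsU (c * c') (mmul m m').
Proof.
apply: fpsP => d; rewrite fpsM /= /fpsU_fun mdegM.
have [->|dn] := eqVneq d (mdeg m + mdeg m')%N.
  have lm : (mdeg m < (mdeg m + mdeg m').+1)%N by rewrite ltnS leq_addr.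
  rewrite (bigD1 (Ordinal lm)) //= eqxx addKn eqxx big1 ?addr0.
    by rewrite malgM_def fgmulUU.
  move=> i /negPf; rewrite -val_eqE /= => ->; by rewrite mul0r.
rewrite big1 // => i _; have [im|] := eqVneq; last by rewrite mul0r.
have [im'|] := eqVneq; last by rewrite mulr0.
by case/eqP: dn; rewrite -im -im' subnKC // -ltnS.
Qed.

Lemma fpsU1 : fpsU 1 mone = 1 :> fps T R. Proof. by []. Qed.

Lemma fpsC_is_zmod_morphism : zmod_morphism (@fpsC T R).
Proof.
move=> a b; apply: fpsP => d; rewrite fpsB /= /fpsU_fun.
by case: eqP => _; rewrite ?subr0 // monalgUB.
Qed.
HB.instance Definition _ := GRing.isZmodMorphism.Build R (fps T R) (@fpsC T R)
  fpsC_is_zmod_morphism.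

Lemma fpsC_is_monoid_morphism : monoid_morphism (@fpsC T R).
Proof. by split=> [//|a b]; rewrite /fpsC fpsUM mulm1. Qed.
HB.instance Definition _ := GRing.isMonoidMorphism.Build R (fps T R) (@fpsC T R)
  fpsC_is_monoid_morphism.

Lemma fps_geC (c : R) : fps_ge 0 (fpsC T c). Proof. by []. Qed.

Lemma fpsX_ge1 (t : T) : fps_ge 1 (fpsX R t).
Proof. by case=> // _; rewrite /= /fpsU_fun mdegU. Qed.

End FpsOrder.

Section Subst.
Variables (T U : choiceType) (R : comNzRingType) (g : T -> fps U R).

Definition mon_eval (m : {cmonom T}) : fps U R :=
  \prod_(t <- finsupp m) g t ^+ m t.

Definition poly_eval (p : {malg R[{cmonom T}]}) : fps U R :=
  mmap (@fpsC U R) mon_eval p.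

Lemma fps_subst_subproof (f : fps T R) d :
  homog d (\sum_(k < d.+1) poly_eval (f k) d).
Proof. apply: homog_sum => k _; exact: hcompP. Qed.

(* The series f(g) = \sum_k f_k(g), where f_k is the homogeneous component of
   degree k of f.  It is meaningful when the constant terms of the series g t
   vanish; then f_k(g) has no term of degree < k, so that the component of
   degree d of the sum only involves the f_k with k <= d. *)
Definition fps_subst (f : fps T R) : fps U R := Fps (fps_subst_subproof f).

Lemma mon_evalE (m : {cmonom T}) (D : {fset T}) : (finsupp m `<=` D)%fset ->
  mon_eval m = \prod_(t <- D) g t ^+ m t.
Proof.
move=> sD; rewrite /mon_eval (big_fset_incl _ sD) // => t _.
by rewrite -cmE_eq0 => /eqP ->; rewrite expr0.
Qed.

Lemma mon_eval_is_mmorphism : mmorphism mon_eval.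
Proof.
split=> [m m'|]; last by rewrite /mon_eval mdom1 big_seq_fset0.
rewrite (@mon_evalE m (finsupp m `|` finsupp m')%fset) ?fsubsetUl //.
rewrite (@mon_evalE m' (finsupp m `|` finsupp m')%fset) ?fsubsetUr //.
rewrite -big_split /mon_eval mdomD /=.
by apply: eq_bigr => t _; rewrite cmM exprD.
Qed.
HB.instance Definition _ :=
  monalg.isMultiplicative.Build _ _ mon_eval mon_eval_is_mmorphism.

HB.instance Definition _ := GRing.RMorphism.copy poly_eval
  (mmap (@fpsC U R) mon_eval).

Hypothesis g_small : forall t, fps_ge 1 (g t).

Lemma mon_eval_ge m : fps_ge (mdeg m) (mon_eval m).
Proof.
rewrite /mdeg /mon_eval; apply: fps_ge_prod => t.
by rewrite -{1}(muln1 (m t)); apply: fps_geX.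
Qed.

Lemma poly_eval_ge k p : homog k p -> fps_ge k (poly_eval p).
Proof.
move=> /homogP hp; rewrite /poly_eval /mmap big_seq_cond; apply: fps_ge_sum.
move=> m; rewrite andbT -mcoeff_neq0 => /hp <-.
by apply: fps_geMr; apply: mon_eval_ge.
Qed.

Lemma fps_substE f d N : (d < N)%N ->
  fps_subst f d = (\sum_(k < N) poly_eval (f k)) d.
Proof.
move=> dN; rewrite /= fps_sum (big_ord_widen _ (fun k => poly_eval (f k) d) dN).
rewrite big_mkcond /=; apply: eq_bigr => k _; case: ifP => // /negbT.
rewrite -leqNgt => dk; rewrite (poly_eval_ge (hcompP f k)) //.
Qed.

Lemma sum_triangle (V : nmodType) N (F : nat -> nat -> V) :
  \sum_(k < N) \sum_(i < k.+1) F i (k - i)%N =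
  \sum_(i < N) \sum_(j < N | (i + j < N)%N) F i j.
Proof.
under eq_bigr => k _.
  have E : \sum_(i < k.+1) F i (k - i)%N =
      \sum_(i < N) \sum_(j < N) (if (i + j == k)%N then F i j else 0).
    rewrite (big_ord_widen _ (fun i => F i (k - i)%N) (ltn_ord k)) big_mkcond /=.
    apply: eq_bigr => i _; rewrite -big_mkcond /=; case: ifP => ik.
      have kiN : (k - i < N)%N by rewrite (leq_ltn_trans (leq_subr _ _)).
      rewrite (big_pred1 (Ordinal kiN)) // => j /=; rewrite -[j == _]val_eqE /=.
      by apply/eqP/eqP => [<-|->]; rewrite ?addKn // subnKC // -ltnS.
    rewrite big1 // => j /eqP ijk; move: ik.
    by rewrite -ijk ltnS leq_addr.
  rewrite E; over.
rewrite exchange_big; apply: eq_bigr => i _.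
rewrite exchange_big [RHS]big_mkcond; apply: eq_bigr => j _ /=.
rewrite -big_mkcond /=; case: ltnP => ijN.
  by rewrite (big_pred1 (Ordinal ijN)) // => k; rewrite eq_sym.
by rewrite big1 // => k /eqP kE; move: (ltn_ord k); rewrite -kE ltnNge ijN.
Qed.

Lemma fps_subst_is_zmod_morphism : zmod_morphism fps_subst.
Proof.
move=> f f'; apply: fpsP => d; rewrite fpsB /= -sumrB.
by apply: eq_bigr => k _; rewrite raddfB.
Qed.

Lemma fps_subst_is_monoid_morphism : monoid_morphism fps_subst.
Proof.
split=> [|f f'].
  apply: fpsP => d; rewrite /= big_ord_recl big1 ?addr0 /= => [|k _].
    by rewrite /fpsU_fun mdeg1 eqxx (rmorph1 poly_eval).
  by rewrite /fpsU_fun mdeg1 raddf0.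
apply: fpsP => d; rewrite (fps_substE _ (ltnSn d)).
have -> : (fps_subst f * fps_subst f') d =
  ((\sum_(k < d.+1) poly_eval (f k)) * (\sum_(k < d.+1) poly_eval (f' k))) d.
  rewrite !fpsM; apply: eq_bigr => i _; rewrite !(@fps_substE _ _ d.+1) //.
  by rewrite ltnS leq_subr.
rewrite big_distrlr /=.
under eq_bigr => k _ do rewrite raddf_sum /=.
under eq_bigr => k _ do under eq_bigr => i _ do rewrite rmorphM /=.
rewrite (sum_triangle _ (fun i j => poly_eval (f i) * poly_eval (f' j))).
rewrite !fps_sum; apply: eq_bigr => i _; rewrite !fps_sum big_mkcond /=.
apply: eq_bigr => j _; case: ifP => // /negbT; rewrite -leqNgt => dij.
by symmetry; apply: (@fps_geM U R i j) dij; apply: poly_eval_ge; apply: hcompP.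
Qed.

Lemma fps_subst_ge k f : fps_ge k f -> fps_ge k (fps_subst f).
Proof.
move=> hf d dk; rewrite /= big1 // => i _; rewrite hf ?raddf0 //.
by rewrite (leq_trans _ dk) // ltnS -ltnS.
Qed.

Lemma fps_substC c : fps_subst (fpsC T c) = fpsC U c.
Proof.
apply: fpsP => d; rewrite /= big_ord_recl big1 ?addr0 /= => [|k _].
  by rewrite /fpsU_fun mdeg1 eqxx; rewrite /poly_eval mmapU mmorph1 mulr1.
by rewrite /fpsU_fun mdeg1 raddf0.
Qed.

Lemma mon_evalU t : mon_eval (ucm t) = g t.
Proof. by rewrite /mon_eval mdomU big_seq_fset1 cmUU expr1. Qed.

Lemma fps_substX t : fps_subst (fpsX R t) = g t.
Proof.
apply: fpsP => d.
have E k : poly_eval (fpsX R t k) d = if k == 1%N then g t d else 0.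
  rewrite /= /fpsU_fun mdegU; case: eqP => _; last by rewrite raddf0.
  rewrite /poly_eval mmapU mon_evalU.
  exact: (congr1 (fun f : fps U R => f d) (mul1r (g t))).
rewrite /=; under eq_bigr => k _ do rewrite E.
case: d E => [|d] E; first by rewrite big_ord1 /= g_small.
by rewrite big_ord_recl add0r big_ord_recl /= big1 ?addr0.
Qed.

End Subst.

Lemma eq_fps_subst (T U : choiceType) (R : comNzRingType) (g h : T -> fps U R) f :
  g =1 h -> fps_subst g f = fps_subst h f.
Proof. by move=> /funext ->. Qed.

Lemma fps_subst_comp (T U V : choiceType) (R : comNzRingType)
    (g : U -> fps V R) (h : T -> fps U R) (f : fps T R) :
  (forall u, fps_ge 1 (g u)) -> (forall t, fps_ge 1 (h t)) ->
  fps_subst g (fps_subst h f) = fps_subst (fun t => fps_subst g (h t)) f.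
Proof.
move=> sg sh.
have [phi phiE] : exists phi : {rmorphism fps U R -> fps V R},
    forall x, phi x = fps_subst g x.
  pose A := GRing.isZmodMorphism.Build _ _ _ (fps_subst_is_zmod_morphism g).
  pose B := GRing.isMonoidMorphism.Build _ _ _ (fps_subst_is_monoid_morphism sg).
  pose phi : {rmorphism fps U R -> fps V R} := HB.pack (fps_subst g) A B.
  by exists phi.
have sgh t : fps_ge 1 (fps_subst g (h t)) by apply: fps_subst_ge.
have E p : phi (poly_eval h p) = poly_eval (fun t => fps_subst g (h t)) p.
  rewrite /poly_eval /mmap rmorph_sum; apply: eq_bigr => m _.
  rewrite rmorphM phiE fps_substC; congr (_ * _).
  rewrite /mon_eval rmorph_prod; apply: eq_bigr => t _.
  by rewrite rmorphXn phiE.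
apply: fpsP => d; rewrite [RHS](fps_substE sgh _ (ltnSn d)).
under [in RHS]eq_bigr => k _ do rewrite -E.
rewrite -rmorph_sum phiE /=.
apply/eqP; rewrite -subr_eq0 -sumrB; apply/eqP/big1 => k _; rewrite -fpsB -raddfB.
rewrite (_ : fps_subst h f k - _ = 0) ?raddf0 //.
by rewrite (fps_substE sh _ (ltn_ord k : (k < d.+1)%N)) subrr.
Qed.

Lemma mon_evalX (T : choiceType) (R : comNzRingType) (m : {cmonom T}) :
  mon_eval (@fpsX T R) m = fpsU 1 m.
Proof.
pose pw t n : {cmonom T} := iter n (mmul (ucm t)) mone.
have pwE t n i : pw t n i = (n * (t == i))%N.
  by elim: n => [|n IHn]; rewrite /= ?cm1 // cmM cmU IHn mulSn.
have XE t n : fpsX R t ^+ n = fpsU 1 (pw t n).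
  by elim: n => [|n IHn]; rewrite ?expr0 // exprS IHn fpsUM mulr1.
have prodE (s : seq T) : \prod_(t <- s) fpsX R t ^+ m t =
    fpsU 1 (\big[mmul/mone]_(t <- s) pw t (m t)).
  elim: s => [|t s IHs]; rewrite ?big_nil // !big_cons IHs XE fpsUM mulr1.
  by [].
rewrite /mon_eval prodE; congr (fpsU 1 _); apply/eqP/cmP => i.
have sumE (s : seq T) : (\big[mmul/mone]_(t <- s) pw t (m t)) i =
    (\sum_(t <- s) m t * (t == i))%N.
  elim: s => [|t s IHs]; rewrite ?big_nil ?cm1 // !big_cons cmM IHs pwE.
  by [].
rewrite sumE; case: (mdomP m i) => im.
  rewrite (big_fsetD1 i) //= eqxx muln1 big1_fset ?addn0 // => j.
  by rewrite in_fsetD1 => /andP[/negPf-> _] _; rewrite muln0.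
rewrite big1_fset // => j jm _; case: eqP jm => [->|_]; last by rewrite muln0.
by rewrite (negPf im).
Qed.

Lemma fps_subst_id (T : choiceType) (R : comNzRingType) (f : fps T R) :
  fps_subst (@fpsX T R) f = f.
Proof.
apply: fpsP => d.
have E k : poly_eval (@fpsX T R) (f k) d = if k == d then f k else 0.
  rewrite /poly_eval /mmap fps_sum.
  transitivity (\sum_(m <- msupp (f k))
      if k == d then << (f k)@_m *g m >> else 0).
    rewrite [LHS]big_seq [RHS]big_seq; apply: eq_bigr => m; rewrite -mcoeff_neq0.
    move=> /(homogP _ _ (hcompP f k)) mk.
    by rewrite mon_evalX /fpsC fpsUM mulr1 mul1m /= /fpsU_fun mk eq_sym.
  case: eqP => _; last by rewrite big1.
  by rewrite -monalgE.
rewrite /=; under eq_bigr => k _ do rewrite E.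
by rewrite big_ord_recr /= eqxx big1 ?add0r // => k _; rewrite ltn_eqF.
Qed.

Definition fps_subst2 (U : choiceType) (R : comNzRingType) (F : fps 'I_2 R)
  (f g : fps U R) : fps U R := fps_subst (tnth [tuple f; g]) F.

Record formal_group_law (R : comNzRingType) := FormalGroupLaw {
  fgl_series :> fps 'I_2 R;
  fgl_x0 : let x := fpsX R (inord 0 : 'I_1) in
    fps_subst2 fgl_series x 0 = x;
  fgl_comm : let x := fpsX R (inord 0 : 'I_2) in
    let y := fpsX R (inord 1 : 'I_2) in
    fps_subst2 fgl_series x y = fps_subst2 fgl_series y x;
  fgl_assoc : let x := fpsX R (inord 0 : 'I_3) in
    let y := fpsX R (inord 1 : 'I_3) in let z := fpsX R (inord 2 : 'I_3) in
    fps_subst2 fgl_series x (fps_subst2 fgl_series y z) =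
    fps_subst2 fgl_series (fps_subst2 fgl_series x y) z
}.

Lemma tuple2_ge1 (U : choiceType) (R : comNzRingType) (f g : fps U R) :
  fps_ge 1 f -> fps_ge 1 g -> forall i, fps_ge 1 (tnth [tuple f; g] i).
Proof. by move=> hf hg; case=> [[|[|//]]] i. Qed.

Lemma fgl_ge1 (R : comNzRingType) (F : formal_group_law R) : fps_ge 1 F.
Proof.
case=> // _; have F0 := hcompP F 0%N.
have hx0 : forall i, fps_ge 1 (tnth [tuple fpsX R (inord 0 : 'I_1); 0] i).
  by apply: tuple2_ge1 => //; apply: fpsX_ge1.
have E : F 0%N = malgC (F 0%N)@_mone.
  apply/malgP => m; rewrite mcoeffC.
  have [->|mn] := eqVneq m mone; first by rewrite mulr1n.
  rewrite mulr0n; apply/eqP; apply: contraT => /(homogP _ _ F0) /eqP.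
  by rewrite mdeg_eq0 (negPf mn).
have := congr1 (fun f : fps _ R => f 0%N) (fgl_x0 F).
rewrite /fps_subst2 (fps_substE hx0 _ (ltnSn 0)) big_ord1 E /poly_eval.
rewrite mmapU mmorph1 mulr1 /= /fpsU_fun mdeg1 mdegU /=.
move=> /(congr1 (fun p => p@_mone)).
by rewrite mcoeffUU mcoeff0 => ->; rewrite monalgU0.
Qed.

Definition ideal_span (A : comNzRingType) (G : A -> Prop) (a : A) : Prop :=
  exists s : seq (A * A),
    (forall p, p \in s -> G p.2) /\ a = \sum_(p <- s) p.1 * p.2.

Definition fps_closure (T : choiceType) (R : comNzRingType)
    (I : fps T R -> Prop) (f : fps T R) : Prop :=
  forall k, exists g, I g /\ fps_ge k (f - g).

Section FormalGroupAlgebra.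
Variables (L : zmodType) (R : comNzRingType) (F : formal_group_law R).

Definition fga_rel (f : fps L R) : Prop :=
  f = fpsX R (0 : L) \/
  exists l m : L, f = fpsX R (l + m) - fps_subst2 F (fpsX R l) (fpsX R m).

Definition fga_ideal (f : fps L R) : bool :=
  `[< fps_closure (ideal_span fga_rel) f >].

Lemma fga_rel_ge1 f : fga_rel f -> fps_ge 1 f.
Proof.
case=> [->|[l [m ->]]]; first exact: fpsX_ge1.
apply: fps_geB; first exact: fpsX_ge1.
apply: fps_subst_ge; exact: fgl_ge1.
Qed.

Lemma fga_span_rel f : fga_rel f -> ideal_span fga_rel f.
Proof.
move=> hf; exists [:: (1, f)]; rewrite big_seq1 mul1r; split=> // p.
by rewrite inE => /eqP ->.
Qed.

Lemma fga_ideal_closed : idealr_closed fga_ideal.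
Proof.
split.
- apply/asboolP => k; exists 0; split; last by rewrite subrr.
  by exists [::]; rewrite big_nil; split.
- apply/asboolP => /(_ 1%N) [g [[s [hs ->]]]].
  move=> /(_ 0%N isT); rewrite fpsB fps_sum big_seq big1 => [|p ps].
    rewrite subr0 => /eqP; rewrite /= /fpsU_fun mdeg1 eqxx.
    by rewrite (oner_eq0 {malg R[{cmonom L}]}).
  by rewrite fpsM big_ord1 (fga_rel_ge1 (hs _ ps)) // mulr0.
- move=> a f g /asboolP hf /asboolP hg; apply/asboolP => k.
  have [f' [[s [hs ->]] hf']] := hf k; have [g' [[t [ht ->]] hg']] := hg k.
  exists (a * \sum_(p <- s) p.1 * p.2 + \sum_(p <- t) p.1 * p.2); split.
    exists ([seq (a * p.1, p.2) | p <- s] ++ t); split.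
      move=> p; rewrite mem_cat => /orP[/mapP[q qs ->]|]; last exact: ht.
      exact: (hs q).
    rewrite big_cat big_map /= mulr_sumr; congr (_ + _).
    by apply: eq_bigr => p _; rewrite mulrA.
  rewrite opprD addrACA -mulrBr; apply: fps_geD => //; exact: fps_geMr.
Qed.

HB.instance Definition _ := isIdealr.Build (fps L R) fga_ideal fga_ideal_closed.

Definition fga_J : idealr (fps L R) := fga_ideal.

(* R[[L]]_F = R[[x_l | l in L]] / J_F *)
Definition fga := {ideal_quot fga_J}.
HB.instance Definition _ := GRing.ComNzRing.on fga.

Definition fga_pi (f : fps L R) : fga := \pi_fga f.

Lemma fga_piP f g : reflect (fga_pi f = fga_pi g) (f - g \in fga_ideal).
Proof. rewrite Quotient.idealrBE; exact: eqP. Qed.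

Lemma fga_pi_is_zmod_morphism : zmod_morphism fga_pi.
Proof. exact: rmorphB. Qed.
HB.instance Definition _ := GRing.isZmodMorphism.Build (fps L R) fga fga_pi
  fga_pi_is_zmod_morphism.
Lemma fga_pi_is_monoid_morphism : monoid_morphism fga_pi.
Proof. by split; [exact: rmorph1|exact: rmorphM]. Qed.
HB.instance Definition _ := GRing.isMonoidMorphism.Build (fps L R) fga fga_pi
  fga_pi_is_monoid_morphism.

Lemma fga_pi_repr (s : fga) : fga_pi (repr s) = s.
Proof. exact: reprK. Qed.

Definition fga_x (l : L) : fga := fga_pi (fpsX R l).

End FormalGroupAlgebra.

Section FgaMap.
Variables (L L' : zmodType) (R : comNzRingType) (F : formal_group_law R).
Variable phi : {additive L -> L'}.

Definition fps_rename : fps L R -> fps L' R :=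
  fps_subst (fun l => fpsX R (phi l)).

Lemma fps_rename_small l : fps_ge 1 (fpsX R (phi l)).
Proof. exact: fpsX_ge1. Qed.

HB.instance Definition _ := GRing.isZmodMorphism.Build (fps L R) (fps L' R)
  fps_rename (fps_subst_is_zmod_morphism (fun l => fpsX R (phi l))).
HB.instance Definition _ := GRing.isMonoidMorphism.Build (fps L R) (fps L' R)
  fps_rename (fps_subst_is_monoid_morphism fps_rename_small).

Lemma fps_renameX l : fps_rename (fpsX R l) = fpsX R (phi l).
Proof. exact: (fps_substX fps_rename_small). Qed.

Lemma fps_rename_rel f : fga_rel F f -> fga_rel F (fps_rename f).
Proof.
case=> [->|[l [m ->]]]; first by left; rewrite fps_renameX raddf0.
right; exists (phi l), (phi m); rewrite rmorphB /= fps_renameX raddfD.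
congr (_ - _); rewrite /fps_subst2 [LHS]fps_subst_comp.
- apply: eq_fps_subst; case=> [[|[|//]]] i;
    rewrite !(tnth_nth 0) /=; exact: fps_renameX.
- exact: fps_rename_small.
- by apply: tuple2_ge1; exact: fpsX_ge1.
Qed.

Lemma fps_rename_ideal f :
  f \in fga_ideal F -> fps_rename f \in fga_ideal F.
Proof.
move=> /asboolP hf; apply/asboolP => k; have [g [[s [hs ->]] hk]] := hf k.
exists (fps_rename (\sum_(p <- s) p.1 * p.2)); split; last first.
  by rewrite -rmorphB; exact: fps_subst_ge.
exists [seq (fps_rename p.1, fps_rename p.2) | p <- s]; split.
  by move=> p /mapP[q qs ->]; apply: fps_rename_rel; exact: hs.
by rewrite big_map rmorph_sum; apply: eq_bigr => p _; rewrite rmorphM.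
Qed.

(* the homomorphism of R-algebras with x_l |-> x_(phi l) *)
Definition fga_map (s : fga L F) : fga L' F := fga_pi F (fps_rename (repr s)).

Lemma fga_map_pi f : fga_map (fga_pi F f) = fga_pi F (fps_rename f).
Proof.
apply/fga_piP; rewrite -rmorphB; apply: fps_rename_ideal.
by apply/fga_piP; exact: fga_pi_repr.
Qed.

Lemma fga_mapX l : fga_map (fga_x F l) = fga_x F (phi l).
Proof. by rewrite /fga_x fga_map_pi fps_renameX. Qed.

Lemma fga_map_is_zmod_morphism : zmod_morphism fga_map.
Proof.
move=> s t; rewrite -(fga_pi_repr s) -(fga_pi_repr t) -rmorphB !fga_map_pi.
by rewrite !rmorphB.
Qed.
HB.instance Definition _ := GRing.isZmodMorphism.Build (fga L F) (fga L' F)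
  fga_map fga_map_is_zmod_morphism.
Lemma fga_map_is_monoid_morphism : monoid_morphism fga_map.
Proof.
split=> [|s t]; first by rewrite -[1](rmorph1 (@fga_pi L R F)) fga_map_pi !rmorph1.
rewrite -(fga_pi_repr s) -(fga_pi_repr t) -rmorphM !fga_map_pi.
by rewrite !rmorphM.
Qed.
HB.instance Definition _ := GRing.isMonoidMorphism.Build (fga L F) (fga L' F)
  fga_map fga_map_is_monoid_morphism.

End FgaMap.

Lemma fga_map_id (L : zmodType) (R : comNzRingType) (F : formal_group_law R)
  (phi : {additive L -> L}) : phi =1 id -> @fga_map L L R F phi =1 id.
Proof.
move=> e s; rewrite -[RHS]fga_pi_repr /fga_map; congr fga_pi.
by rewrite -[RHS]fps_subst_id; apply: eq_fps_subst => l; rewrite e.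
Qed.

Lemma fga_map_comp (L L' L'' : zmodType) (R : comNzRingType)
    (F : formal_group_law R) (phi : {additive L' -> L''})
    (psi : {additive L -> L'}) (chi : {additive L -> L''}) :
  (forall l, chi l = phi (psi l)) ->
  forall s, @fga_map L L'' R F chi s = fga_map phi (fga_map psi s).
Proof.
move=> e s; rewrite -(fga_pi_repr s) !fga_map_pi; congr fga_pi.
rewrite [RHS]fps_subst_comp; first last.
- exact: fps_rename_small.
- exact: fps_rename_small.
apply: eq_fps_subst => l.
by rewrite (fps_substX (@fps_rename_small _ _ _ phi)) e.
Qed.

Section Localization.
Variables (A : comNzRingType) (M : mulrClosed A).
Implicit Types (a b : A).

Definition denom := {s : A | s \in M}.
Implicit Types (s t : denom) (x y z : A * denom).

Definition frac_eq x y : bool :=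
  `[< exists u, u \in M /\ u * (x.1 * val y.2) = u * (y.1 * val x.2) >].

Lemma frac_eq_refl : reflexive frac_eq.
Proof. by move=> x; apply/asboolP; exists 1; split=> //; exact: rpred1. Qed.

Lemma frac_eq_sym : symmetric frac_eq.
Proof.
by move=> x y; apply/asboolP/asboolP => -[u [uM e]]; exists u; split.
Qed.

Lemma frac_eq_trans : transitive frac_eq.
Proof.
move=> y x z /asboolP[u [uM e]] /asboolP[v [vM e']]; apply/asboolP.
exists (u * v * val y.2); split; first by rewrite !rpredM // (valP y.2).
transitivity (v * val z.2 * (u * (x.1 * val y.2))); first by ring.
rewrite e; transitivity (u * val x.2 * (v * (y.1 * val z.2))); first by ring.
by rewrite e'; ring.
Qed.

Canonical frac_equiv := EquivRel frac_eq frac_eq_refl frac_eq_sym frac_eq_trans.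

(* The ring of fractions A[M^-1].  It is the zero ring when 0 \in M. *)
Definition loc := {eq_quot frac_equiv}.
HB.instance Definition _ := Choice.on loc.
HB.instance Definition _ := EqQuotient.on loc.

Definition frac a s : loc := \pi_loc (a, s).

Lemma fracP a s b t : frac a s = frac b t <->
  exists u, u \in M /\ u * (a * val t) = u * (b * val s).
Proof.
rewrite /frac; split=> [/eqP|h]; last apply/eqP; rewrite eqmodE.
  by move=> /asboolP.
exact/asboolP.
Qed.

Lemma frac_ind (P : loc -> Prop) : (forall a s, P (frac a s)) -> forall q, P q.
Proof. by move=> h q; rewrite -[q]reprK; case: (repr q) => a s; exact: h. Qed.

Definition denom1 : denom := exist _ 1 (rpred1 M).
Definition denomM s t : denom := exist _ (val s * val t) (rpredM (valP s) (valP t)).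

Lemma denomME s t : val (denomM s t) = val s * val t. Proof. by []. Qed.
Lemma denom1E : val denom1 = 1. Proof. by []. Qed.

Definition loc0 := frac 0 denom1.
Definition loc1 := frac 1 denom1.
Definition loc_add (p q : loc) : loc :=
  let: (a, s) := repr p in let: (b, t) := repr q in
  frac (a * val t + b * val s) (denomM s t).
Definition loc_opp (p : loc) : loc := let: (a, s) := repr p in frac (- a) s.
Definition loc_mul (p q : loc) : loc :=
  let: (a, s) := repr p in let: (b, t) := repr q in frac (a * b) (denomM s t).

Lemma repr_frac a s : exists b t, repr (frac a s) = (b, t) /\ frac b t = frac a s.
Proof.
case E: (repr (frac a s)) => [b t]; exists b, t; split => //.
by rewrite {1}/frac -E reprK.
Qed.

Lemma loc_addE a s b t : loc_add (frac a s) (frac b t) =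
  frac (a * val t + b * val s) (denomM s t).
Proof.
rewrite /loc_add; have [a' [s' [-> /fracP[u [uM e]]]]] := repr_frac a s.
have [b' [t' [-> /fracP[v [vM e']]]]] := repr_frac b t.
apply/fracP; exists (u * v); split; first exact: rpredM.
rewrite !denomME.
transitivity (v * val t' * val t * (u * (a' * val s)) +
   u * val s * val s' * (v * (b' * val t))); first by ring.
by rewrite e e'; ring.
Qed.

Lemma loc_oppE a s : loc_opp (frac a s) = frac (- a) s.
Proof.
rewrite /loc_opp; have [a' [s' [-> /fracP[u [uM e]]]]] := repr_frac a s.
by apply/fracP; exists u; split=> //; rewrite !mulNr !mulrN e.
Qed.

Lemma loc_mulE a s b t : loc_mul (frac a s) (frac b t) = frac (a * b) (denomM s t).
Proof.
rewrite /loc_mul; have [a' [s' [-> /fracP[u [uM e]]]]] := repr_frac a s.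
have [b' [t' [-> /fracP[v [vM e']]]]] := repr_frac b t.
apply/fracP; exists (u * v); split; first exact: rpredM.
rewrite !denomME; transitivity (u * (a' * val s) * (v * (b' * val t))); first by ring.
by rewrite e e'; ring.
Qed.

Lemma frac_eqI a s b t : a * val t = b * val s -> frac a s = frac b t.
Proof. by move=> e; apply/fracP; exists 1; rewrite e; split=> //; exact: rpred1. Qed.

Lemma loc_addA : associative loc_add.
Proof.
elim/frac_ind=> a s; elim/frac_ind=> b t; elim/frac_ind=> c r.
by rewrite !loc_addE; apply: frac_eqI; rewrite ?denomME ?denom1E; ring.
Qed.
Lemma loc_addC : commutative loc_add.
Proof.
elim/frac_ind=> a s; elim/frac_ind=> b t.
by rewrite !loc_addE; apply: frac_eqI; rewrite ?denomME ?denom1E; ring.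
Qed.
Lemma loc_add0 : left_id loc0 loc_add.
Proof.
elim/frac_ind=> a s; rewrite !loc_addE; apply: frac_eqI; rewrite ?denomME ?denom1E; ring.
Qed.
Lemma loc_addN : left_inverse loc0 loc_opp loc_add.
Proof.
by elim/frac_ind=> a s; rewrite loc_oppE !loc_addE; apply: frac_eqI; rewrite ?denomME ?denom1E; ring.
Qed.
HB.instance Definition _ :=
  GRing.isZmodule.Build loc loc_addA loc_addC loc_add0 loc_addN.

Lemma loc_mulA : associative loc_mul.
Proof.
elim/frac_ind=> a s; elim/frac_ind=> b t; elim/frac_ind=> c r.
by rewrite !loc_mulE; apply: frac_eqI; rewrite ?denomME ?denom1E; ring.
Qed.
Lemma loc_mulC : commutative loc_mul.
Proof.
elim/frac_ind=> a s; elim/frac_ind=> b t.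
by rewrite !loc_mulE; apply: frac_eqI; rewrite ?denomME ?denom1E; ring.
Qed.
Lemma loc_mul1 : left_id loc1 loc_mul.
Proof.
by elim/frac_ind=> a s; rewrite !loc_mulE; apply: frac_eqI; rewrite ?denomME ?denom1E; ring.
Qed.
Lemma loc_mulD : left_distributive loc_mul loc_add.
Proof.
elim/frac_ind=> a s; elim/frac_ind=> b t; elim/frac_ind=> c r.
by rewrite !(loc_addE, loc_mulE); apply: frac_eqI; rewrite ?denomME ?denom1E; ring.
Qed.
HB.instance Definition _ := GRing.Zmodule_isComPzRing.Build loc
  loc_mulA loc_mulC loc_mul1 loc_mulD.

Lemma fracD a s b t : frac a s + frac b t = frac (a * val t + b * val s) (denomM s t).
Proof. exact: loc_addE. Qed.
Lemma fracN a s : - frac a s = frac (- a) s. Proof. exact: loc_oppE. Qed.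
Lemma fracM a s b t : frac a s * frac b t = frac (a * b) (denomM s t).
Proof. exact: loc_mulE. Qed.
Lemma frac1 : 1 = frac 1 denom1. Proof. by []. Qed.

End Localization.

Section LocMap.
Variables (A B : comNzRingType) (M : mulrClosed A) (N : mulrClosed B).
Variables (f : {rmorphism A -> B}) (fM : forall s, s \in M -> f s \in N).

Definition denom_map (s : denom M) : denom N := exist _ (f (val s)) (fM (valP s)).

(* a / s |-> f(a) / f(s) *)
Definition loc_map (q : loc M) : loc N :=
  let: (a, s) := repr q in frac (f a) (denom_map s).

Lemma loc_mapE a s : loc_map (frac a s) = frac (f a) (denom_map s).
Proof.
rewrite /loc_map; have [a' [s' [-> /fracP[u [uM e]]]]] := repr_frac a s.
apply/fracP; exists (f u); split; first exact: fM.
by rewrite /= -!rmorphM e.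
Qed.

Lemma loc_map_is_zmod_morphism : zmod_morphism loc_map.
Proof.
elim/frac_ind=> a s; elim/frac_ind=> b t.
rewrite fracN fracD !loc_mapE fracN fracD; apply: frac_eqI.
by rewrite /= rmorphD !rmorphM rmorphN.
Qed.
HB.instance Definition _ := GRing.isZmodMorphism.Build (loc M) (loc N) loc_map
  loc_map_is_zmod_morphism.

Lemma loc_map_is_monoid_morphism : monoid_morphism loc_map.
Proof.
split; first by rewrite !frac1 loc_mapE; apply: frac_eqI; rewrite /= rmorph1.
elim/frac_ind=> a s; elim/frac_ind=> b t.
by rewrite fracM !loc_mapE fracM; apply: frac_eqI; rewrite /= !rmorphM.
Qed.
HB.instance Definition _ := GRing.isMonoidMorphism.Build (loc M) (loc N) loc_map
  loc_map_is_monoid_morphism.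

End LocMap.

Record ring_action (G : finGroupType) (Q : pzRingType) := RingAction {
  ract :> G -> {rmorphism Q -> Q};
  ract1 : forall q, ract 1%g q = q;
  ractM : forall g h q, ract (g * h)%g q = ract g (ract h q)
}.

(* Q_G, the free left Q-module on G, as functions G -> Q: the function x is
   the element \sum_g x(g) delta_g. *)
Definition twisted (G : finGroupType) (Q : pzRingType) (act : ring_action G Q) :=
  {ffun G -> Q}.

Section Twisted.
Variables (G : finGroupType) (Q : pzRingType) (act : ring_action G Q).
Local Notation QG := (twisted act).
Implicit Types (x y z : QG) (g h : G).

HB.instance Definition _ := GRing.Lmodule.copy QG {ffun G -> Q^o}.

Lemma twistedZ (q : Q) x g : (q *: x) g = q * x g.
Proof. by rewrite ffunE. Qed.
Lemma twistedD x y g : (x + y) g = x g + y g.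
Proof. by rewrite ffunE. Qed.
Lemma twisted_sum (I : Type) (r : seq I) (P : pred I) (F : I -> QG) g :
  (\sum_(i <- r | P i) F i) g = \sum_(i <- r | P i) F i g.
Proof. exact: sum_ffunE. Qed.

Definition delta g : QG := [ffun h => (h == g)%:R].

(* Bilinear extension of (p delta_g) (q delta_h) = p g(q) delta_(gh). *)
Definition twisted_mul x y : QG :=
  \sum_g \sum_h (x g * act g (y h)) *: delta (g * h)%g.

Lemma deltaE g h : delta g h = (h == g)%:R.
Proof. by rewrite ffunE. Qed.

Lemma twistedE x : x = \sum_g x g *: delta g.
Proof.
apply/ffunP => h; rewrite twisted_sum (bigD1 h) //= twistedZ deltaE eqxx mulr1.
rewrite big1 ?addr0 // => g /negPf gh.
by rewrite twistedZ deltaE eq_sym gh mulr0.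
Qed.

Lemma twisted_mulE x y k : twisted_mul x y k = \sum_g x g * act g (y (g^-1 * k)%g).
Proof.
rewrite twisted_sum; apply: eq_bigr => g _; rewrite twisted_sum.
rewrite (bigD1 (g^-1 * k)%g) //= twistedZ deltaE mulKVg eqxx mulr1 big1 ?addr0 //.
move=> h hk; rewrite twistedZ deltaE -(inj_eq (mulgI g^-1%g)) mulKg eq_sym.
by rewrite (negPf hk) mulr0.
Qed.

Lemma twisted_mulA : associative twisted_mul.
Proof.
move=> x y z; apply/ffunP => k; rewrite !twisted_mulE.
under eq_bigr => g _ do rewrite twisted_mulE rmorph_sum mulr_sumr.
under [RHS]eq_bigr => g _ do rewrite twisted_mulE mulr_suml.
rewrite [RHS]exchange_big; apply: eq_bigr => g _ /=.
rewrite [RHS](reindex_inj (mulgI g)); apply: eq_bigr => h _ /=.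
by rewrite mulKg rmorphM ractM invMg !mulgA mulrA.
Qed.

Lemma twisted_mul1l : left_id (delta 1%g) twisted_mul.
Proof.
move=> x; apply/ffunP => k; rewrite twisted_mulE (bigD1 1%g) //= deltaE eqxx.
rewrite mul1r ract1 invg1 mul1g big1 ?addr0 // => g /negPf g1.
by rewrite deltaE g1 mul0r.
Qed.

Lemma twisted_mul1r : right_id (delta 1%g) twisted_mul.
Proof.
move=> x; apply/ffunP => k; rewrite twisted_mulE (bigD1 k) //= deltaE mulVg eqxx.
rewrite rmorph1 mulr1 big1 ?addr0 // => g gk.
by rewrite deltaE -eq_mulVg1 (negPf gk) rmorph0 mulr0.
Qed.

Lemma twisted_mulDl : left_distributive twisted_mul +%R.
Proof.
move=> x y z; apply/ffunP => k; rewrite twistedD !twisted_mulE -big_split /=.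
by apply: eq_bigr => g _; rewrite twistedD mulrDl.
Qed.

Lemma twisted_mulDr : right_distributive twisted_mul +%R.
Proof.
move=> x y z; apply/ffunP => k; rewrite twistedD !twisted_mulE -big_split /=.
by apply: eq_bigr => g _; rewrite twistedD rmorphD mulrDr.
Qed.

HB.instance Definition _ := GRing.Zmodule_isPzRing.Build QG twisted_mulA
  twisted_mul1l twisted_mul1r twisted_mulDl twisted_mulDr.

Lemma twisted1 : 1 = delta 1%g. Proof. by []. Qed.

Lemma twistedM (p q : Q) g h :
  (p *: delta g) * (q *: delta h) = (p * act g q) *: delta (g * h)%g.
Proof.
apply/ffunP => k; rewrite twisted_mulE (bigD1 g) //= big1 ?addr0; last first.
  by move=> l /negPf lg; rewrite twistedZ deltaE lg mulr0 mul0r.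
rewrite !twistedZ !deltaE eqxx mulr1 -(inj_eq (mulgI g)) mulKVg.
by case: eqP => _; rewrite ?mulr1 // !mulr0 rmorph0 mulr0.
Qed.

End Twisted.

Section Dual.
Variables (A : comPzRingType) (V : lmodType A).

Definition scalar_pred (phi : V -> A^o) : bool := `[< linear phi >].

Lemma scalar_pred_closed : subsemimod_closed scalar_pred.
Proof.
split; first split.
- by apply/asboolP => a u v; rewrite /= scaler0 addr0.
- move=> f g /asboolP hf /asboolP hg; apply/asboolP => a u v.
  by rewrite /GRing.add /= hf hg scalerDr addrACA.
- move=> c f /asboolP hf; apply/asboolP => a u v.
  have E w : (c *: f) w = c *: f w by [].
  by rewrite !E hf scalerDr !scalerA (mulrC a).
Qed.
HB.instance Definition _ :=
  GRing.isSubmodClosed.Build A (V -> A^o) scalar_pred scalar_pred_closed.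

(* Hom_A(V, A) *)
Record dual := Dual { dual_fun :> V -> A^o; _ : scalar_pred dual_fun }.
HB.instance Definition _ := [isSub for dual_fun].
HB.instance Definition _ := [Choice of dual by <:].
HB.instance Definition _ := [SubChoice_isSubLmodule of dual by <:].

Lemma dual_linear (phi : dual) : linear phi.
Proof. by case: phi => phi /= /asboolP. Qed.
HB.instance Definition _ (phi : dual) :=
  GRing.isLinear.Build A V A^o *:%R phi (dual_linear phi).

End Dual.

(* Coordinates of x in a basis e of V: the family c with
   x = \sum_i c i *: e i (by convention 0 if there is none). *)
Definition coefs (A : pzRingType) (V : lmodType A) (I : finType) (e : I -> V)
  (x : V) : {ffun I -> A} := xget 0 [set c : {ffun I -> A} | x = \sum_i c i *: e i].

(* The basis of Hom_A(V, A) dual to a basis e of V (by convention 0 if there is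
   no such linear form). *)
Definition dual_basis (A : comPzRingType) (V : lmodType A) (I : finType)
  (e : I -> V) (i : I) : dual V :=
  xget 0 [set phi : dual V | forall j, phi (e j) = (j == i)%:R].

Definition is_basis (A : pzRingType) (V : lmodType A) (I : finType)
  (e : I -> V) : Prop :=
  forall x, exists! c : {ffun I -> A}, x = \sum_i c i *: e i.

Lemma coefsP (A : pzRingType) (V : lmodType A) (I : finType) (e : I -> V) x :
  is_basis e -> x = \sum_i coefs e x i *: e i.
Proof.
move=> /(_ x) [c [ce _]]; rewrite /coefs.
by case: xgetP => [d _ //|/(_ c)].
Qed.

Lemma coefs_unique (A : pzRingType) (V : lmodType A) (I : finType) (e : I -> V)
    (x : V) (c : {ffun I -> A}) :
  is_basis e -> x = \sum_i c i *: e i -> coefs e x = c.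
Proof.
move=> eb xc; have [d [_ du]] := eb x.
by rewrite -(du _ xc) -(du _ (coefsP x eb)).
Qed.

Lemma dual_basisP (A : comPzRingType) (V : lmodType A) (I : finType)
    (e : I -> V) i j : is_basis e -> dual_basis e i (e j) = (j == i)%:R.
Proof.
move=> eb; rewrite /dual_basis; case: xgetP => [phi _ -> //|no].
have lin : scalar_pred (fun x => coefs e x i : A^o).
  apply/asboolP => a u v; rewrite -[RHS]/(a * coefs e u i + coefs e v i).
  rewrite (@coefs_unique _ _ _ e _ [ffun i => a * coefs e u i + coefs e v i] eb).
    by rewrite ffunE.
  under eq_bigr => k _ do rewrite ffunE scalerDl -scalerA.
  by rewrite big_split -scaler_sumr /= -!coefsP.
case: (no (Dual lin)) => k /=.
rewrite (@coefs_unique _ _ _ e _ [ffun i => (k == i)%:R] eb) ?ffunE //.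
rewrite (bigD1 k) //= ffunE eqxx scale1r big1 ?addr0 // => l /negPf lk.
by rewrite ffunE eq_sym lk scale0r.
Qed.

Section TwistedDual.
Variables (G : finGroupType) (Q : comPzRingType) (act : ring_action G Q).

Definition twisted_dual := dual (twisted act).
HB.instance Definition _ := GRing.Lmodule.on twisted_dual.
Implicit Types (phi psi chi : twisted_dual).

Lemma fdual_subproof g :
  scalar_pred (fun x : twisted act => x g : Q^o).
Proof. by apply/asboolP => a u v; rewrite twistedD twistedZ. Qed.

Definition fdual g : twisted_dual := Dual (fdual_subproof g).

(* Q-bilinear product with f_g f_h = f_g if g = h, and 0 otherwise *)
Definition twisted_dual_mul phi psi : twisted_dual :=
  \sum_g (phi (delta act g) * psi (delta act g) : Q) *: fdual g.

Lemma dualD phi psi x : (phi + psi) x = phi x + psi x. Proof. by []. Qed.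
Lemma dualZ (a : Q) phi x : (a *: phi) x = a * phi x :> Q. Proof. by []. Qed.
Lemma dual_sum (I : Type) (r : seq I) (P : pred I) (F : I -> twisted_dual) x :
  (\sum_(i <- r | P i) F i) x = \sum_(i <- r | P i) F i x.
Proof. by elim/big_rec2: _ => // i p f _ <-. Qed.

Lemma fdual_delta g h : fdual g (delta act h) = (g == h)%:R.
Proof. exact: deltaE. Qed.

Lemma dual_expand phi x :
  phi x = \sum_g (x g * phi (delta act g) : Q) :> Q.
Proof.
rewrite [in LHS](twistedE x) linear_sum; apply: eq_bigr => g _.
exact: (linearZ_LR phi).
Qed.

Lemma dual_deltaP phi psi :
  (forall g, phi (delta act g) = psi (delta act g)) -> phi = psi.
Proof.
move=> e; apply/val_inj/funext => x /=; rewrite [LHS]dual_expand [RHS]dual_expand.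
by apply: eq_bigr => g _; rewrite e.
Qed.

Lemma twisted_dual_mulE phi psi g :
  twisted_dual_mul phi psi (delta act g) =
  (phi (delta act g) : Q) * psi (delta act g) :> Q.
Proof.
rewrite dual_sum (bigD1 g) // dualZ fdual_delta eqxx mulr1 big1 => [|h /negPf hg].
  exact: addr0.
by rewrite dualZ fdual_delta hg mulr0.
Qed.

Lemma twisted_dual_mulA : associative twisted_dual_mul.
Proof.
move=> f g h; apply: dual_deltaP => w; apply: etrans (twisted_dual_mulE _ _ _) _.
apply: etrans _ (esym (twisted_dual_mulE _ _ _)).
by rewrite !twisted_dual_mulE mulrA.
Qed.
Lemma twisted_dual_mulC : commutative twisted_dual_mul.
Proof.
by move=> f g; apply: eq_bigr => w _; rewrite mulrC.
Qed.
Lemma twisted_dual_mul1 : left_id (\sum_g fdual g) twisted_dual_mul.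
Proof.
move=> f; apply: dual_deltaP => w; apply: etrans (twisted_dual_mulE _ _ _) _.
rewrite dual_sum (bigD1 w) // fdual_delta eqxx big1 => [|h /negPf hg].
  by rewrite [X in X * _]addr0 mul1r.
by rewrite fdual_delta hg.
Qed.
Lemma twisted_dual_mulD : left_distributive twisted_dual_mul +%R.
Proof.
move=> f g h; rewrite /twisted_dual_mul -big_split; apply: eq_bigr => w _.
by rewrite /= -scalerDl -mulrDl.
Qed.
HB.instance Definition _ := GRing.Zmodule_isComPzRing.Build twisted_dual
  twisted_dual_mulA twisted_dual_mulC twisted_dual_mul1 twisted_dual_mulD.

Lemma fdualM g h : fdual g * fdual h = if g == h then fdual g else 0.
Proof.
apply: dual_deltaP => k; apply: etrans (twisted_dual_mulE _ _ _) _.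
rewrite !fdual_delta; case: (eqVneq g h) => [<-|gh].
  by rewrite fdual_delta -natrM mulnb andbb.
have [gk|_] := eqVneq g k; last by rewrite mul0r.
have [hk|_] := eqVneq h k; last by rewrite mulr0.
by rewrite gk hk eqxx in gh.
Qed.

End TwistedDual.

(* A lattice of rank n is identified with Z^n, written as column vectors, and
   its dual with row vectors. *)
Definition pairing (n : nat) (f : 'rV[int]_n) (l : 'cV[int]_n) : int :=
  (f *m l) 0 0.

Record root_datum (n : nat) := RootDatum {
  roots : {fset 'cV[int]_n};
  (* alpha |-> alpha^vee; only its values on roots matter *)
  coroot : 'cV[int]_n -> 'rV[int]_n;
  simple_root : 'I_n -> 'cV[int]_n;
  roots_reduced : forall alpha, alpha \in roots -> alpha *+ 2 \notin roots;
  coroot_inj : {in roots &, injective coroot};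
  coroot2 : forall alpha, alpha \in roots -> pairing (coroot alpha) alpha = 2;
  roots_refl : forall alpha beta, alpha \in roots -> beta \in roots ->
    beta - pairing (coroot alpha) beta *: alpha \in roots;
  coroots_refl : forall alpha beta, alpha \in roots -> beta \in roots ->
    exists2 gamma, gamma \in roots &
      coroot gamma = coroot beta - pairing (coroot beta) alpha *: coroot alpha;
  (* semisimple: the roots span the lattice over Q *)
  roots_span : forall l : 'cV[int]_n, exists m : nat, (0 < m)%N /\
    exists c : 'cV[int]_n -> int, l *+ m = \sum_(alpha <- roots) c alpha *: alpha;
  simple_rootP : forall i, simple_root i \in roots;
  simple_root_free : forall c : 'I_n -> int,
    \sum_i c i *: simple_root i = 0 -> forall i, c i = 0;
  simple_root_pos : forall alpha, alpha \in roots -> exists c : 'I_n -> nat,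
    alpha = \sum_i simple_root i *+ c i \/ alpha = - \sum_i simple_root i *+ c i
}.

Section Weyl.
Variables (n : nat) (D : root_datum n).
Local Notation lattice := 'cV[int]_n.
Implicit Types (alpha beta l : lattice) (I : seq 'I_n).

(* the matrix of l |-> l - alpha^vee(l) alpha *)
Definition refl_mx alpha : 'M[int]_n := 1%:M - alpha *m coroot D alpha.

Lemma refl_mxE alpha l :
  refl_mx alpha *m l = l - pairing (coroot D alpha) l *: alpha.
Proof.
rewrite mulmxBl mul1mx -mulmxA; congr (_ - _).
by rewrite [coroot D alpha *m l]mx11_scalar mul_mx_scalar.
Qed.

Lemma refl_mxK alpha : alpha \in roots D -> refl_mx alpha *m refl_mx alpha = 1%:M.
Proof.
move=> ha; rewrite {2}/refl_mx mulmxBr mulmx1 mulmxA refl_mxE coroot2 //.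
have -> : alpha - 2 *: alpha = - alpha by rewrite scaler_nat mulr2n opprD addNKr.
by rewrite mulNmx opprK subrK.
Qed.

Definition word_mx I : 'M[int]_n :=
  \prod_(i <- I) refl_mx (simple_root D i).

Lemma word_mx_cat I J : word_mx (I ++ J) = word_mx I *m word_mx J.
Proof. exact: big_cat. Qed.

Lemma word_mx0 : word_mx [::] = 1%:M.
Proof. exact: big_nil. Qed.
Lemma word_mx_cons i I : word_mx (i :: I) = refl_mx (simple_root D i) *m word_mx I.
Proof. exact: big_cons. Qed.
Lemma word_mx1 i : word_mx [:: i] = refl_mx (simple_root D i).
Proof. exact: big_seq1. Qed.

Lemma word_mx_rev I : word_mx (rev I) *m word_mx I = 1%:M.
Proof.
elim: I => [|i I IHI]; first by rewrite word_mx0 mulmx1.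
rewrite rev_cons -cats1 word_mx_cat -mulmxA word_mx1 word_mx_cons.
by rewrite (mulmxA (refl_mx _)) refl_mxK ?simple_rootP // mul1mx.
Qed.

Lemma word_mx_root I alpha : alpha \in roots D -> word_mx I *m alpha \in roots D.
Proof.
move=> ha; elim: I => [|i I IHI]; first by rewrite word_mx0 mul1mx.
rewrite word_mx_cons -mulmxA refl_mxE; apply: roots_refl => //.
exact: simple_rootP.
Qed.

(* The Weyl group, as the group of automorphisms of the lattice generated by
   the simple reflections (which are involutions). *)
Record weyl : predArgType := Weyl {
  weyl_mx :> 'M[int]_n;
  weylP : `[< exists I, weyl_mx = word_mx I >]
}.
HB.instance Definition _ := [isSub for weyl_mx].
HB.instance Definition _ := [Choice of weyl by <:].
Implicit Types (u v w : weyl).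

Lemma weyl_word w : exists I, w = word_mx I :> 'M_n.
Proof. exact/asboolP/weylP. Qed.

Lemma weyl_root w alpha : alpha \in roots D -> w *m alpha \in roots D.
Proof. by have [I ->] := weyl_word w; exact: word_mx_root. Qed.

Lemma weyl_inj_roots (A B : 'M[int]_n) :
  (forall alpha, alpha \in roots D -> A *m alpha = B *m alpha) -> A = B.
Proof.
move=> e; suff e' l : A *m l = B *m l.
  apply/matrixP => i j.
  have /matrixP/(_ i 0) := e' (delta_mx j 0).
  by rewrite -!colE !mxE.
have [m [m0 [c lE]]] := roots_span D l.
apply/eqP; rewrite -subr_eq0 -mulmxBl.
have : ((A - B) *m l) *+ m = 0.
  rewrite -raddfMn /= lE mulmx_sumr big_seq big1 // => alpha ha.
  by rewrite -scalemxAr mulmxBl e // subrr scaler0.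
move=> /matrixP z; apply/eqP/matrixP => i j; move: (z i j).
rewrite mulmxnE !mxE => /eqP; rewrite Num.Theory.mulrn_eq0 => /orP[/eqP m00|/eqP //].
by rewrite m00 in m0.
Qed.

Definition weyl_on_roots w : {ffun roots D -> option (roots D)} :=
  [ffun alpha => insub (w *m val alpha)].

Lemma weyl_on_roots_inj : injective weyl_on_roots.
Proof.
move=> u v e; apply/val_inj/weyl_inj_roots => alpha ha.
have := congr1 (fun f : {ffun _ -> _} => f [` ha]%fset) e; rewrite !ffunE /=.
by rewrite !insubT ?weyl_root // => hu hv /(congr1 (oapp val 0)).
Qed.

Definition weyl_of_roots (f : {ffun roots D -> option (roots D)}) : option weyl :=
  if pselect (exists w, weyl_on_roots w = f) is left p then Some (projT1 (cid p))
  else None.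

Lemma weyl_on_rootsK : pcancel weyl_on_roots weyl_of_roots.
Proof.
move=> w; rewrite /weyl_of_roots; case: pselect => [p|[]]; last by exists w.
by case: cid => v /= /weyl_on_roots_inj ->.
Qed.
HB.instance Definition _ : isCountable weyl := PCanIsCountable weyl_on_rootsK.
HB.instance Definition _ : isFinite weyl := PCanIsFinite weyl_on_rootsK.

Lemma weyl1_subproof : `[< exists I, 1%:M = word_mx I >].
Proof. by apply/asboolP; exists [::]; rewrite word_mx0. Qed.
Definition weyl1 := Weyl weyl1_subproof.

Lemma weyl_mul_subproof u v :
  `[< exists I, (u : 'M_n) *m (v : 'M_n) = word_mx I >].
Proof.
have [I ->] := weyl_word u; have [J ->] := weyl_word v.
by apply/asboolP; exists (I ++ J); rewrite word_mx_cat.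
Qed.
Definition weyl_mul u v := Weyl (weyl_mul_subproof u v).

Lemma weyl_inv_ex w : exists v, weyl_mul v w = weyl1.
Proof.
have [I wI] := weyl_word w.
have vP : `[< exists J, word_mx (rev I) = word_mx J >] by apply/asboolP; exists (rev I).
by exists (Weyl vP); apply/val_inj; rewrite /= wI word_mx_rev.
Qed.
Definition weyl_inv w : weyl := projT1 (cid (weyl_inv_ex w)).

Lemma weyl_mulA : associative weyl_mul.
Proof. by move=> u v w; apply/val_inj; exact: mulmxA. Qed.
Lemma weyl_mul1 : left_id weyl1 weyl_mul.
Proof. by move=> w; apply/val_inj; exact: mul1mx. Qed.
Lemma weyl_mulV : left_inverse weyl1 weyl_inv weyl_mul.
Proof. by move=> w; rewrite /weyl_inv; case: cid. Qed.
HB.instance Definition _ :=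
  Finite_isGroup.Build weyl weyl_mulA weyl_mul1 weyl_mulV.

Lemma simple_refl_subproof i : `[< exists I, refl_mx (simple_root D i) = word_mx I >].
Proof. by apply/asboolP; exists [:: i]; rewrite word_mx1. Qed.
Definition simple_refl (i : 'I_n) : weyl := Weyl (simple_refl_subproof i).

(* w = s_(i_1) ... s_(i_k) is a reduced expression *)
Definition reduced_word w I : Prop :=
  (\prod_(i <- I) simple_refl i)%g = w /\
  forall J, (\prod_(j <- J) simple_refl j)%g = w -> (size I <= size J)%N.

Variables (R : comNzRingType) (F : formal_group_law R).

Local Notation S := (fga lattice F).

Definition regular_roots : Prop :=
  forall alpha, alpha \in roots D -> GRing.lreg (fga_x F alpha : S).

(* the multiplicative set generated by the x_alpha, for alpha a root *)
Definition root_denoms (s : S) : bool :=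
  `[< exists r : seq lattice, {subset r <= roots D} /\
      s = \prod_(alpha <- r) fga_x F alpha >].

Lemma root_denoms_closed : GRing.mulr_closed root_denoms.
Proof.
split; first by apply/asboolP; exists [::]; rewrite big_nil; split.
move=> s t /asboolP[p [hp ->]] /asboolP[q [hq ->]]; apply/asboolP.
exists (p ++ q); rewrite big_cat; split=> // alpha.
by rewrite mem_cat => /orP[/hp|/hq].
Qed.
HB.instance Definition _ := GRing.isMulClosed.Build S root_denoms root_denoms_closed.

Definition root_denoms_mul := GRing.MulClosed.clone S root_denoms _.

(* Q = S[1/x_alpha | alpha a root] *)
Definition locQ := loc root_denoms_mul.
HB.instance Definition _ := GRing.ComPzRing.on locQ.

Definition weyl_S w : S -> S := @fga_map lattice lattice R F (mulmx w).
HB.instance Definition _ w := GRing.RMorphism.on (weyl_S w).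

Lemma weyl_Sx w l : weyl_S w (fga_x F l) = fga_x F (w *m l).
Proof. exact: fga_mapX. Qed.

Lemma weyl_denoms w s : s \in root_denoms_mul -> weyl_S w s \in root_denoms_mul.
Proof.
move=> /asboolP[r [hr ->]]; apply/asboolP.
exists [seq w *m alpha | alpha <- r]; split.
  by move=> beta /mapP[alpha /hr ha ->]; exact: weyl_root.
rewrite rmorph_prod big_map; apply: eq_bigr => alpha _; exact: weyl_Sx.
Qed.

Definition weyl_Q w : {rmorphism locQ -> locQ} :=
  loc_map (@weyl_denoms w).

Lemma weyl_Q1 q : weyl_Q 1%g q = q.
Proof.
elim/frac_ind: q => a s; rewrite /weyl_Q /= loc_mapE.
have E b : weyl_S 1%g b = b by apply: fga_map_id => l; exact: mul1mx.
by apply: frac_eqI; rewrite /= !E.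
Qed.

Lemma weyl_QM u v q : weyl_Q (u * v)%g q = weyl_Q u (weyl_Q v q).
Proof.
elim/frac_ind: q => a s; rewrite /weyl_Q /= !loc_mapE.
have E b : weyl_S (u * v)%g b = weyl_S u (weyl_S v b).
  by apply: fga_map_comp => l; exact: esym (mulmxA _ _ _).
by apply: frac_eqI; rewrite /= !E.
Qed.

Definition weyl_action : ring_action weyl locQ := RingAction weyl_Q1 weyl_QM.

Definition QW := twisted weyl_action.
HB.instance Definition _ := GRing.Lmodule.on QW.
HB.instance Definition _ := GRing.PzRing.on QW.

Definition QW_dual := twisted_dual weyl_action.
HB.instance Definition _ := GRing.Lmodule.on QW_dual.
HB.instance Definition _ := GRing.ComPzRing.on QW_dual.

Definition deltaW w : QW := delta weyl_action w.

Definition Z_simple (a b : 'I_n -> locQ) (i : 'I_n) : QW :=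
  a i *: (1 : QW) + b i *: deltaW (simple_refl i).

Definition Z_word (a b : 'I_n -> locQ) I : QW := \prod_(i <- I) Z_simple a b i.

Section Coefficients.
Variables (a b : 'I_n -> locQ) (I_ : weyl -> seq 'I_n).

Definition Z_basis w : QW := Z_word a b (I_ w).
Definition Z_dual w : QW_dual := dual_basis Z_basis w.

(* b^Z_{u, I_w}, defined by delta_u = \sum_w b^Z_{u, I_w} Z_(I_w) *)
Definition b_coef u w : locQ := coefs Z_basis (deltaW u) w.

(* c^{I_w}_{I_u, I_v}, defined by
   Z_(I_u)^* Z_(I_v)^* = \sum_w c^{I_w}_{I_u, I_v} Z_(I_w)^* *)
Definition c_coef w u v : locQ := coefs Z_dual (Z_dual u * Z_dual v) w.

(* W x W matrices, indexed through the enumeration of W *)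
Definition mxW (f : weyl -> weyl -> locQ) : 'M[locQ]_#|weyl| :=
  \matrix_(i, j) f (enum_val i) (enum_val j).

Definition p_mx w := mxW (fun u v => c_coef v w u).
Definition b_mx := mxW (fun u v => b_coef v u).
Definition bdiag_mx w := mxW (fun u v => (u == v)%:R * b_coef u w).

End Coefficients.

End Weyl.

(* Main.v *)
Require Import Defs.
From mathcomp Require Import all_boot all_algebra.
From mathcomp Require Import fingroup.

Set Implicit Arguments.
Unset Strict Implicit.
Unset Printing Implicit Defensive.

Import GRing.Theory.
Local Open Scope ring_scope.

(** Evaluating a linear form at all the delta_x identifies the dual of Q_W with
    the ring of functions W -> Q under the pointwise product, so multiplication
    by a fixed form is diagonal in the coordinates f_x.  Since
    Z_(I_u)^* (delta_x) = b^Z_{x,I_u}, the matrix b^Z is the change of basis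
    between these coordinates and the basis Z^*, the matrix b^Z_w is the
    multiplication by Z_(I_w)^* in the coordinates f_x, and p^Z_w is the same
    multiplication in the basis Z^*: the theorem says that these two are
    conjugate under b^Z ([mul_dual_basis_delta], [coefs_delta_mulV]).

    The same argument applies to any basis of Q_W.  The Z_(I_w) form one because
    they are triangular with respect to the length.  When the product Z_I is
    expanded, the choice of delta_i in every factor gives the product of all the
    reflections of I, with a coefficient that is a product of W-translates of
    the units b_i; every other choice gives a product of fewer than [size I]
    simple reflections ([Z_word_leading]).  For I = I_w reduced, the first term
    is a unit times delta_w and the others are supported on elements of smaller
    length, so that [triangular_is_basis] applies. *)

(** * Bases *)

Lemma dual_lincomb (A : comPzRingType) (V : lmodType A) (I : finType)
    (phi : dual V) (c : I -> A) (x : I -> V) :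
  phi (\sum_i c i *: x i) = \sum_i c i * phi (x i) :> A.
Proof.
by rewrite linear_sum; apply: eq_bigr => i _; exact: (linearZ_LR phi).
Qed.

Lemma is_basis_dual (A : comPzRingType) (V : lmodType A) (I : finType)
    (e : I -> V) : is_basis e -> is_basis (dual_basis e).
Proof.
move=> eb; have dualE (c : {ffun I -> A}) i :
    (\sum_j c j *: dual_basis e j) (e i) = c i.
  have -> : (\sum_j c j *: dual_basis e j) (e i) =
      \sum_j c j * dual_basis e j (e i) :> A.
    by elim/big_rec2: _ => // j p phi _ <-.
  rewrite (bigD1 i) //= dual_basisP // eqxx mulr1 big1 ?addr0 // => j /negPf ji.
  by rewrite dual_basisP // eq_sym ji mulr0.
move=> phi; exists [ffun i => phi (e i)]; split=> [|c phiE]; last first.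
  by apply/ffunP => i; rewrite ffunE phiE dualE.
apply/val_inj/boolp.funext => x.
rewrite (coefsP x eb) [LHS]dual_lincomb [RHS]dual_lincomb.
by apply: eq_bigr => i _; rewrite dualE ffunE.
Qed.

Section TwistedBasis.
Variables (G : finGroupType) (Q : comPzRingType) (act : ring_action G Q).
Local Notation QG := (twisted act).
Variable e : G -> QG.

(** [delta g] is obtained by solving the expansion of [e g] for its leading
    term, by induction on [l g]; independence is read off at a maximal element
    of the support. *)
Lemma triangular_is_basis (l : G -> nat) :
  (forall g, exists c, c * e g g = 1) ->
  (forall g h, h != g -> (l g <= l h)%N -> e g h = 0) -> is_basis e.
Proof.
move=> eunit etri; pose spanned (x : QG) := exists c : {ffun G -> Q},
  x = \sum_g c g *: e g.
have spanD x y : spanned x -> spanned y -> spanned (x + y).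
  move=> [c ->] [d ->]; exists (c + d); rewrite -big_split.
  by apply: eq_bigr => g _; rewrite ffunE scalerDl.
have spanZ q x : spanned x -> spanned (q *: x).
  move=> [c ->]; exists [ffun g => q * c g]; rewrite scaler_sumr.
  by apply: eq_bigr => g _; rewrite ffunE scalerA.
have span0 : spanned 0.
  by exists 0; rewrite big1 // => g _; rewrite ffunE scale0r.
have spane g : spanned (e g).
  exists [ffun h => (h == g)%:R]; rewrite (bigD1 g) //= ffunE eqxx scale1r.
  by rewrite big1 ?addr0 // => h /negPf hg; rewrite ffunE hg scale0r.
have span_delta g : spanned (delta act g).
  have [m] := ubnP (l g); elim: m g => // m IHm g lgm; have [c cK] := eunit g.
  have -> : delta act g =
      c *: (e g + (-1) *: \sum_(h | h != g) e g h *: delta act h).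
    rewrite {1}[e g]twistedE (bigD1 g) //= scaleN1r addrK scalerA.
    by rewrite cK scale1r.
  apply: (spanZ); apply: (spanD) => //; apply: (spanZ).
  elim/big_rec: _ => // h x hg xs; apply: (spanD) => //.
  have [lgh|lhg] := leqP (l g) (l h); first by rewrite etri // scale0r.
  by apply: (spanZ); apply: IHm; apply: leq_trans lhg _; rewrite -ltnS.
have indep (d : {ffun G -> Q}) : \sum_g d g *: e g = 0 -> forall g, d g = 0.
  move=> de g; apply/eqP; apply: contraT => dg.
  (* for h maximizing l on the support of d, only the term [d h *: e h] of the
     sum contributes to the coefficient of [delta h] *)
  case: (@arg_maxnP G g (fun h => d h != 0) l dg) => h dh hmax.
  have [c cK] := eunit h; case/eqP: dh.
  suff dhe : d h * e h h = 0 by rewrite -[LHS]mulr1 -cK mulrCA dhe mulr0.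
  have := congr1 (fun x : QG => x h) de; rewrite twisted_sum (bigD1 h) //=.
  rewrite twistedZ big1 ?addr0 => [->|k kh]; first by rewrite ffunE.
  rewrite twistedZ; have [->|dk] := eqVneq (d k) 0; first by rewrite mul0r.
  by rewrite etri ?mulr0 // 1?eq_sym //; exact: hmax.
move=> x; have [c xc] : spanned x.
  by rewrite [x]twistedE; elim/big_rec: _ => // g y _; apply: (spanD); apply: (spanZ).
exists c; split=> // c' xc'; apply/ffunP => g; apply/eqP; rewrite -subr_eq0.
suff /(_ g) : forall h, (c - c') h = 0 by rewrite !ffunE => ->.
apply: indep; rewrite -[RHS](subrr x) {1}xc xc' -sumrB.
by apply: eq_bigr => h _; rewrite !ffunE scalerBl.
Qed.

Hypothesis eb : is_basis e.

(** This gives the coefficients of [delta h] in e a multiplicative meaning: as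
    values of forms at [delta h], they multiply when the forms do. *)
Lemma dual_basis_delta g h :
  dual_basis e g (delta act h) = coefs e (delta act h) g.
Proof.
rewrite [in LHS](coefsP (delta act h) eb) [LHS]dual_lincomb (bigD1 g) //=.
rewrite dual_basisP // eqxx mulr1 big1 ?addr0 // => k /negPf kg.
by rewrite dual_basisP // kg mulr0.
Qed.

(** The coordinates [e k g] of e in the basis [delta], and those of [delta] in
    the basis e, are inverse matrices; one order is the duality of e and its
    dual basis, the other is the expansion of [delta h] in e. *)
Lemma coefs_delta_mulV g h :
  \sum_k coefs e (delta act k) g * e h k = (g == h)%:R.
Proof.
have := dual_basisP g h eb; rewrite eq_sym => <-.
rewrite [RHS](dual_expand (dual_basis e g : twisted_dual act)).
by apply: eq_bigr => k _; rewrite dual_basis_delta mulrC.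
Qed.

Lemma coefs_delta_mulVr g h :
  \sum_k e k g * coefs e (delta act h) k = (g == h)%:R.
Proof.
rewrite -(deltaE act) [in RHS](coefsP (delta act h) eb) twisted_sum.
by apply: eq_bigr => k _; rewrite twistedZ mulrC.
Qed.

(** Both sides are the value of the product of the two dual basis elements at
    [delta x], where the product is pointwise. *)
Lemma mul_dual_basis_delta g h x :
  let E g : twisted_dual act := dual_basis e g in
  \sum_k coefs E (E g * E h) k * coefs e (delta act x) k =
  coefs e (delta act x) h * coefs e (delta act x) g.
Proof.
move=> E; have := twisted_dual_mulE (E g) (E h) x.
rewrite {1 2}/E !dual_basis_delta mulrC => <-.
rewrite -[twisted_dual_mul _ _]/(E g * E h).
rewrite [in RHS](coefsP (E g * E h) (is_basis_dual eb)) dual_sum.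
by apply: eq_bigr => k _; rewrite dualZ dual_basis_delta.
Qed.

End TwistedBasis.

(** * Triangularity of the products of the Z_i *)

Section WeylBasis.
Variables (n : nat) (D : root_datum n) (R : comNzRingType).
Variables (F : formal_group_law R) (a b : 'I_n -> locQ D F).
Hypothesis b_inv : forall i, exists c, b i * c = 1.

Lemma Z_simple_mulE i (x : QW D F) g : (Z_simple a b i * x) g =
  a i * x g + b i * weyl_Q F (simple_refl D i) (x ((simple_refl D i)^-1 * g)%g).
Proof.
rewrite /Z_simple mulrDl twistedD; congr (_ + _).
  rewrite [LHS]twisted_mulE (bigD1 1%g) //= twistedZ deltaE eqxx mulr1.
  rewrite weyl_Q1 invg1 mul1g big1 ?addr0 // => h /negPf h1.
  by rewrite twistedZ deltaE h1 mulr0 mul0r.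
rewrite [LHS]twisted_mulE (bigD1 (simple_refl D i)) //= twistedZ deltaE eqxx.
rewrite mulr1 big1 ?addr0 // => h /negPf hi.
by rewrite twistedZ deltaE hi mulr0 mul0r.
Qed.

(** By induction on I: in (a_i + b_i delta_i) Z_I the summand a_i Z_I only
    involves products of at most [size I] reflections, so that the leading term
    comes from b_i delta_i c = b_i s_i(c) delta_i.  Minimality is required of
    the group element g and not of the word I, because the tail of I has to be
    treated at elements that are arbitrary translates of g. *)
Lemma Z_word_leading I : exists2 c : locQ D F, exists c', c' * c = 1 &
  forall g, (forall J, (\prod_(j <- J) simple_refl D j)%g = g ->
                       (size I <= size J)%N) ->
    Z_word a b I g = c * (g == (\prod_(i <- I) simple_refl D i)%g)%:R.
Proof.
elim: I => [|i I [c [c' cK] IHI]].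
  exists 1 => [|g _]; first by exists 1; rewrite mulr1.
  by rewrite /Z_word !big_nil mul1r; exact: deltaE.
have [d bd] := b_inv i; set s := simple_refl D i.
exists (b i * weyl_Q F s c) => [|g gmin].
  exists (d * weyl_Q F s c').
  by rewrite mulrACA (mulrC d) bd mul1r -rmorphM cK rmorph1.
rewrite /Z_word big_cons -/(Z_word a b I) Z_simple_mulE -/s.
rewrite IHI; last by move=> J /gmin/ltnW.
rewrite IHI; last first.
  move=> J Jg; have := gmin (i :: J).
  by rewrite big_cons -/s Jg mulKVg ltnS; apply.
rewrite big_cons -/s -(inj_eq (mulgI s) (s^-1 * g)%g) mulKVg.
(* g is not a product of [size I] reflections, so the term a_i * Z_I drops out *)
have /negPf-> : g != (\prod_(j <- I) simple_refl D j)%g.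
  by apply/eqP => gE; have := gmin I (esym gE); rewrite ltnn.
by rewrite !mulr0 add0r rmorphM rmorph_nat mulrA.
Qed.

Lemma Z_basisP (I_ : weyl D -> seq 'I_n) :
  (forall w, reduced_word w (I_ w)) -> is_basis (Z_basis a b I_).
Proof.
move=> I_red; apply: (@triangular_is_basis _ _ _ _ (fun w => size (I_ w))).
  move=> w; have [wE wmin] := I_red w; have [c [c' cK] Ic] := Z_word_leading (I_ w).
  by exists c'; rewrite /Z_basis Ic // wE eqxx mulr1.
move=> w v /negPf vw lwv; have [wE _] := I_red w; have [_ vmin] := I_red v.
have [c _ Ic] := Z_word_leading (I_ w); rewrite /Z_basis Ic ?wE ?vw ?mulr0 //.
by move=> J /vmin; apply: leq_trans.
Qed.

Lemma mxW_mul (f g h : weyl D -> weyl D -> locQ D F) :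
  (forall u v, \sum_x f u x * g x v = h u v) -> mxW f *m mxW g = mxW h.
Proof.
move=> fgh; apply/matrixP => i j; rewrite !mxE -fgh.
rewrite [RHS](reindex _ (onW_bij _ (@enum_val_bij (weyl D)))).
by apply: eq_bigr => k _; rewrite !mxE.
Qed.

Lemma mxW1 : mxW (fun u v => (u == v)%:R : locQ D F) = 1%:M.
Proof. by apply/matrixP => i j; rewrite !mxE (inj_eq enum_val_inj). Qed.

End WeylBasis.

(** * Conjugation by the change of basis *)

Theorem theorem8p1 (n : nat) (D : root_datum n)
    (R : comNzRingType) (F : formal_group_law R)
    (regF : regular_roots D F)
    (a b : 'I_n -> locQ D F) (b_inv : forall i, exists c, b i * c = 1)
    (I_ : weyl D -> seq 'I_n) (I_red : forall w, reduced_word w (I_ w))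
    (w : weyl D) :
  exists B' : 'M[locQ D F]_#|{: weyl D}|,
    [/\ b_mx a b I_ *m B' = 1%:M,
        B' *m b_mx a b I_ = 1%:M
      & p_mx a b I_ w = b_mx a b I_ *m bdiag_mx a b I_ w *m B'].
Proof.
have Zb := Z_basisP a b_inv I_red; pose B' := mxW (fun v u => Z_basis a b I_ u v).
have BK : b_mx a b I_ *m B' = 1%:M.
  by rewrite -mxW1; apply: mxW_mul => u v; exact: coefs_delta_mulV.
exists B'; split=> //.
  by rewrite -mxW1; apply: mxW_mul => u v; exact: coefs_delta_mulVr.
have pB : p_mx a b I_ w *m b_mx a b I_ = b_mx a b I_ *m bdiag_mx a b I_ w.
  rewrite (mxW_mul (h := fun u x => b_coef a b I_ x u * b_coef a b I_ x w)).
    symmetry; apply: mxW_mul => u x; rewrite (bigD1 x) //= eqxx mul1r.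
    by rewrite big1 ?addr0 // => y /negPf yx; rewrite yx mul0r mulr0.
  by move=> u x; exact: mul_dual_basis_delta.
by rewrite -pB -mulmxA BK mulmx1.
Qed.
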